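(* Let $H_1\subset U_2$ be the finite group generated by $T=\frac{1+i}{2}\begin{pmatrix}1&1\\1&-1\end{pmatrix}$ and $D=\begin{pmatrix}1&0\\0&i\end{pmatrix}$. Then the sixteen representations $(\rho_i,V_i)$, $1\le i\le 16$, of $H_1$ defined in the context form a complete set of representatives of the isomorphism classes of irreducible complex representations of $H_1$ (each $\rho_i$ is irreducible, they are pairwise non-isomorphic, and every irreducible complex representation of $H_1$ is isomorphic to one of them).
   Context: The representations are defined as follows; all are complex, and tensor products carry the diagonal action. Dimension 1: $\rho_1$ is the trivial representation; $\rho_3=\det$ (so $T\mapsto -i$, $D\mapsto i$); $\rho_2=\rho_3^{\otimes 2}$ (so $T,D\mapsto -1$); $\rho_4=\rho_2\otimes\rho_3$. Dimension 2: $\rho_{10}$ is the natural representation on $V_{10}=\mathbb{C}^2$ with standard basis $e_1,e_2$, each matrix of $H_1$ acting by matrix multiplication; $\rho_7=\rho_3\otimes\rho_{10}$, $\rho_8=\rho_2\otimes\rho_{10}$, $\rho_9=\rho_4\otimes\rho_{10}$. Dimension 3: $\rho_{13}$ is the subrepresentation of $\rho_{10}\otimes\rho_{10}$ on the span $V_{13}$ of $e'_1=e_1\otimes e_1$, $e'_2=e_1\otimes e_2+e_2\otimes e_1$, $e'_3=e_2\otimes e_2$; $\rho_{11}=\rho_3\otimes\rho_{13}$, $\rho_{12}=\rho_4\otimes\rho_{13}$, $\rho_{14}=\rho_2\otimes\rho_{13}$. Dimension 4: $\rho_{15}$ is the subrepresentation of $\rho_{10}\otimes\rho_{13}$ on the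 span $V_{15}$ of $e''_1=e_1\otimes e'_1$, $e''_2=e_1\otimes e'_2+e_2\otimes e'_1$, $e''_3=e_1\otimes e'_3+e_2\otimes e'_2$, $e''_4=e_2\otimes e'_3$; $\rho_{16}=\rho_3\otimes\rho_{15}$. Remaining two of dimension 2: $\rho_5$ is the subrepresentation of $\rho_{10}\otimes\rho_{15}$ on the span $V_5$ of $e'''_1=e_1\otimes e''_1+e_2\otimes e''_4$ and $e'''_2=e_1\otimes e''_3+e_2\otimes e''_2$; $\rho_6=\rho_3\otimes\rho_5$. The spans $V_{13},V_{15},V_5$ are $H_1$-invariant subspaces. *)

(* Defs.v *)
From HB Require Import structures.
From mathcomp Require Import all_boot all_order all_algebra all_fingroup.
From mathcomp Require Import mxrepresentation character.
From mathcomp Require Import boolp.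
From mathcomp Require Import ring.

Set Implicit Arguments.
Unset Strict Implicit.
Unset Printing Implicit Defensive.

Import Order.TTheory GRing.Theory Num.Theory.

Local Open Scope ring_scope.

(** * The group H_1 *)

Definition mx2 (A : Type) (a b c d : A) : 'M[A]_2 :=
  \matrix_(i, j) if i == 0 then (if j == 0 then a else b)
                 else (if j == 0 then c else d).

Lemma mx2_mul (A : pzRingType) (a b c d a' b' c' d' : A) :
  mx2 a b c d *m mx2 a' b' c' d' =
  mx2 (a * a' + b * c') (a * b' + b * d') (c * a' + d * c') (c * b' + d * d').
Proof.
apply/matrixP => i j; rewrite !mxE big_ord_recl big_ord1 !mxE /=.
by case: (i == 0); case: (j == 0).
Qed.

Section Generators.
Variable C : numClosedFieldType.

Definition matT : 'M[C]_2 := ((1 + 'i) / 2) *: mx2 1 1 1 (-1).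
Definition matD : 'M[C]_2 := mx2 1 0 0 'i.

(* The subgroup of GL_2(C) generated by [matT] and [matD]. *)
Inductive inH1 : 'M[C]_2 -> Prop :=
| inH1_T : inH1 matT
| inH1_D : inH1 matD
| inH1_1 : inH1 1%:M
| inH1_M x y : inH1 x -> inH1 y -> inH1 (x *m y)
| inH1_V x : inH1 x -> inH1 (invmx x).

Let two_neq0 : 2 != 0 :> C. Proof. by rewrite pnatr_eq0. Qed.

Lemma inH1_unitary x : inH1 x -> x \is unitarymx.
Proof.
elim=> {x} [||| x y _ xU _ yU | x _ xU].
- apply/unitarymxP/matrixP => i j; rewrite !mxE big_ord_recl big_ord1 !mxE /=.
  rewrite !rmorphM /= rmorphD rmorph1 fmorphV /= conjCi conjC_nat.
  have := sqrCi C; move: 'i => w Hw; rewrite expr2 in Hw.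
  by case: i j => -[|[|[]]] // ? [] [|[|[]]] //= ?;
    rewrite ?rmorph1 ?rmorphN1 ?mulr1n ?mulr0n; field: Hw.
- apply/unitarymxP/matrixP => i j; rewrite !mxE big_ord_recl big_ord1 !mxE /=.
  have := mulCii C.
  case: i j => -[|[|[]]] // ? [] [|[|[]]] //= ? H;
    rewrite ?rmorph1 ?rmorph0 ?conjCi ?mulr1n ?mulr0n; ring: H.
- by apply/unitarymxP; rewrite trmx1 map_mx1 mulmx1.
- exact: mul_unitarymx.
- by rewrite invmx_unitary // trmxC_unitary.
Qed.

End Generators.

(** Finiteness of H_1. *)

Module Finiteness.

(* The quadruple [(a, b, c, d)] of Gaussian integers encodes the matrix
   [2^-1 *: mx2 a b c d]; every element of H_1 is of this form. *)
Definition gauss := (int * int)%type.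
Definition gmat := (gauss * gauss * gauss * gauss)%type.

Definition gadd (x y : gauss) : gauss := (x.1 + y.1, x.2 + y.2).
Definition gmul (x y : gauss) : gauss :=
  (x.1 * y.1 - x.2 * y.2, x.1 * y.2 + x.2 * y.1).
Definition gmmul (x y : gmat) : gmat :=
  let: (a, b, c, d) := x in let: (a', b', c', d') := y in
  (gadd (gmul a a') (gmul b c'), gadd (gmul a b') (gmul b d'),
   gadd (gmul c a') (gmul d c'), gadd (gmul c b') (gmul d d')).
Definition ghalf (x : gauss) : gauss := ((x.1 %/ 2)%Z, (x.2 %/ 2)%Z).
Definition gmhalf (x : gmat) : gmat :=
  let: (a, b, c, d) := x in (ghalf a, ghalf b, ghalf c, ghalf d).
Definition gdbl (x : gauss) : gauss := gadd x x.
Definition gmdbl (x : gmat) : gmat :=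
  let: (a, b, c, d) := x in (gdbl a, gdbl b, gdbl c, gdbl d).

Definition gT : gmat := ((1, 1), (1, 1), (1, 1), (-1, -1)).
Definition gD : gmat := ((2, 0), (0, 0), (0, 0), (0, 2)).
Definition g1 : gmat := ((2, 0), (0, 0), (0, 0), (2, 0)).

Definition step (s : seq gmat) :=
  undup (s ++ [seq gmhalf (gmmul x y) | x <- s, y <- [:: gT; gD]]).
Definition elts : seq gmat := Eval vm_compute in iter 10 step [:: g1].

Definition mul_closed :=
  all (fun x => all (fun y =>
    let z := gmmul x y in let h := gmhalf z in
    (gmdbl h == z) && (h \in elts)) elts) elts.
Definition inv_closed :=
  all (fun x => has (fun y => gmmul x y == gmdbl g1) elts) elts.

Lemma mul_closedT : mul_closed. Proof. by vm_cast_no_check (erefl true). Qed.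
Lemma inv_closedT : inv_closed. Proof. by vm_cast_no_check (erefl true). Qed.

Section Decode.
Variable C : numClosedFieldType.

Let two_neq0 : 2 != 0 :> C. Proof. by rewrite pnatr_eq0. Qed.

Definition gval (x : gauss) : C := x.1%:~R + x.2%:~R * 'i.
Definition decode (x : gmat) : 'M[C]_2 :=
  let: (a, b, c, d) := x in 2^-1 *: mx2 (gval a) (gval b) (gval c) (gval d).

Lemma gvalD x y : gval (gadd x y) = gval x + gval y.
Proof. by rewrite /gval /= !intrD; ring. Qed.

Lemma gvalM x y : gval (gmul x y) = gval x * gval y.
Proof.
rewrite /gval /= intrB intrD !intrM; have H := mulCii C; move: 'i H => w H.
by ring: H.
Qed.

Lemma decode_dbl x : decode (gmdbl x) = 2 *: decode x.
Proof.
case: x => [[[a b] c] d]; apply/matrixP => i j; rewrite !mxE /gdbl !gvalD.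
by case: (i == 0); case: (j == 0); field.
Qed.

Lemma decodeM x y : decode (gmmul x y) = 2 *: (decode x *m decode y).
Proof.
case: x => [[[a b] c] d]; case: y => [[[a' b'] c'] d'] /=.
rewrite -scalemxAl -scalemxAr mx2_mul !scalerA !gvalD !gvalM.
by congr (_ *: _); field.
Qed.

Lemma decode1 : decode g1 = 1%:M.
Proof.
apply/matrixP => i j; rewrite !mxE /gval /=.
by case: i j => -[|[|[]]] // ? [] [|[|[]]] //= ?; field.
Qed.

Lemma inH1_decode x : inH1 x -> exists2 l, l \in elts & x = decode l.
Proof.
elim=> {x} [||| x y _ [l lP ->] _ [m mP ->] | x _ [l lP ->]].
- exists gT => //; apply/matrixP => i j; rewrite !mxE /gval /=.
  by case: (i == 0); case: (j == 0); rewrite ?intrN; field.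
- exists gD => //; apply/matrixP => i j; rewrite !mxE /gval /=.
  by case: (i == 0); case: (j == 0); field.
- by exists g1 => //; rewrite decode1.
- have /allP/(_ l lP)/allP/(_ m mP)/andP[/eqP lmE lmP] := mul_closedT.
  exists (gmhalf (gmmul l m)) => //.
  apply: (scalerI two_neq0).
  by rewrite -decode_dbl lmE decodeM.
- have /allP/(_ l lP)/hasP[m mP /eqP lmE] := inv_closedT.
  exists m => //.
  have lm1 : decode l *m decode m = 1%:M.
    by apply: (scalerI two_neq0); rewrite -decodeM lmE decode_dbl decode1.
  have [lU _] := mulmx1_unit lm1.
  by rewrite -[RHS](mulKmx lU) lm1 mulmx1.
Qed.

End Decode.
End Finiteness.

Record H1 (C : numClosedFieldType) :=
  MkH1 { H1val :> 'M[C]_2; H1valP : `[< inH1 H1val >] }.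

HB.instance Definition _ C := [isSub for @H1val C].
HB.instance Definition _ C := [Choice of H1 C by <:].

Section H1Group.
Variable C : numClosedFieldType.
Implicit Types x y z : H1 C.

Lemma H1_inH1 x : inH1 (val x).
Proof. exact/asboolP/(valP x). Qed.

Let H1_code x : exists l : seq_sub Finiteness.elts,
  val x == Finiteness.decode C (val l).
Proof.
have [l lP xE] := Finiteness.inH1_decode (H1_inH1 x).
by exists (SeqSub lP); rewrite xE.
Qed.

Let code x := xchoose (H1_code x).
Let uncode (l : seq_sub Finiteness.elts) : option (H1 C) :=
  insub (Finiteness.decode C (val l)).

Let codeK : pcancel code uncode.
Proof. by move=> x; rewrite /uncode -(eqP (xchooseP (H1_code x))) valK. Qed.

HB.instance Definition _ : isCountable (H1 C) := PCanIsCountable codeK.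
HB.instance Definition _ : isFinite (H1 C) := PCanIsFinite codeK.

Definition H1T : H1 C := MkH1 (asboolT (inH1_T C)).
Definition H1D : H1 C := MkH1 (asboolT (inH1_D C)).
Definition H1one : H1 C := MkH1 (asboolT (inH1_1 C)).
Definition H1mul x y : H1 C := MkH1 (asboolT (inH1_M (H1_inH1 x) (H1_inH1 y))).
Definition H1inv x : H1 C := MkH1 (asboolT (inH1_V (H1_inH1 x))).

Lemma H1_unit x : val x \in unitmx.
Proof. exact/unitarymx_unit/inH1_unitary/H1_inH1. Qed.

Let H1mulA : associative H1mul.
Proof. by move=> x y z; apply: val_inj; rewrite /= mulmxA. Qed.
Let H1mul1 : left_id H1one H1mul.
Proof. by move=> x; apply: val_inj; rewrite /= mul1mx. Qed.
Let H1mulV : left_inverse H1one H1inv H1mul.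
Proof. by move=> x; apply: val_inj; rewrite /= mulVmx ?H1_unit. Qed.

HB.instance Definition _ := Finite_isGroup.Build (H1 C) H1mulA H1mul1 H1mulV.

End H1Group.

(** * Tensor products and subrepresentations *)

(* [std k] is the k-th standard basis vector, counted from 1. *)
Definition std {R : pzRingType} {n} (k : nat) : 'cV[R]_n :=
  \col_(i < n) (i.+1 == k)%:R.

Definition tensv (F : fieldType) m n (u : 'cV[F]_m) (v : 'cV[F]_n) :
  'cV[F]_(m * n) := tprod u v.

(* The functional dual to [std i ⊗ std j] in the basis of these tensors. *)
Definition dualv (F : fieldType) m n (i j : nat) : 'rV[F]_(m * n) :=
  tprod (std i : 'cV[F]_m)^T (std j : 'cV_n)^T.

Definition cols_mx (R : pzRingType) n (s : seq 'cV[R]_n) : 'M[R]_(n, size s) :=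
  \matrix_(i, j) s`_j i 0.

Notation "u ⊗ v" := (tensv u v) (at level 40, left associativity).

Section TensorVectors.
Variable F : fieldType.

Lemma tprodDl m1 n1 (A A' : 'M[F]_(m1, n1)) m2 n2 (B : 'M[F]_(m2, n2)) :
  tprod (A + A') B = tprod A B + tprod A' B.
Proof.
elim: m1 A A' => [|m1 IH] A A' /=; first by rewrite addr0.
by rewrite !linearD /= IH -trowbE linearD /= add_col_mx.
Qed.

Lemma tprodZl m1 n1 c (A : 'M[F]_(m1, n1)) m2 n2 (B : 'M[F]_(m2, n2)) :
  tprod (c *: A) B = c *: tprod A B.
Proof.
elim: m1 A => [|m1 IH] A /=; first by rewrite scaler0.
by rewrite !linearZ /= IH -trowbE linearZ /= scale_col_mx.
Qed.

Lemma tprodDr m1 n1 (A : 'M[F]_(m1, n1)) m2 n2 (B B' : 'M[F]_(m2, n2)) :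
  tprod A (B + B') = tprod A B + tprod A B'.
Proof.
elim: m1 A => [|m1 IH] A /=; first by rewrite addr0.
by rewrite IH linearD /= add_col_mx.
Qed.

Lemma tprodZr m1 n1 c (A : 'M[F]_(m1, n1)) m2 n2 (B : 'M[F]_(m2, n2)) :
  tprod A (c *: B) = c *: tprod A B.
Proof.
elim: m1 A => [|m1 IH] A /=; first by rewrite scaler0.
by rewrite IH linearZ /= scale_col_mx.
Qed.

Lemma tensvDl m n (u u' : 'cV[F]_m) (v : 'cV[F]_n) :
  (u + u') ⊗ v = u ⊗ v + u' ⊗ v.
Proof. exact: (@tprodDl m 1 u u' n 1 v). Qed.
Lemma tensvDr m n (u : 'cV[F]_m) (v v' : 'cV[F]_n) :
  u ⊗ (v + v') = u ⊗ v + u ⊗ v'.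
Proof. exact: (@tprodDr m 1 u n 1 v v'). Qed.
Lemma tensvZl m n c (u : 'cV[F]_m) (v : 'cV[F]_n) :
  (c *: u) ⊗ v = c *: (u ⊗ v).
Proof. exact: (@tprodZl m 1 c u n 1 v). Qed.
Lemma tensvZr m n c (u : 'cV[F]_m) (v : 'cV[F]_n) :
  u ⊗ (c *: v) = c *: (u ⊗ v).
Proof. exact: (@tprodZr m 1 c u n 1 v). Qed.

Lemma tensv0 m n (u : 'cV[F]_m) : u ⊗ (0 : 'cV[F]_n) = 0.
Proof. by rewrite -[0 in LHS](scale0r (0 : 'cV_n)) tensvZr scale0r. Qed.

Lemma tprod_tensv m n (A : 'M[F]_m) (B : 'M[F]_n) u v :
  tprod A B *m (u ⊗ v) = (A *m u) ⊗ (B *m v).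
Proof. exact: (esym (@tprodE _ m m 1 A u n n 1 B v)). Qed.

Lemma tprod11 (a b : F) :
  tprod (a%:M : 'M_1) (b%:M : 'M_1) = (a * b)%:M :> 'M_1.
Proof.
transitivity ((a * b) *: tprod (1%:M : 'M[F]_1) (1%:M : 'M[F]_1)).
  by rewrite -[a%:M]scalemx1 -[b%:M]scalemx1 tprodZl tprodZr scalerA.
by rewrite tprod1 scalemx1.
Qed.

Lemma dual_tensv m n i j k l : (0 < i)%N -> (0 < j)%N ->
  (i <= m)%N -> (j <= n)%N ->
  dualv F m n i j *m (std k ⊗ std l) =
  ((i == k) && (j == l))%:R%:M.
Proof.
move=> i0 j0 im jn.
have dual p a b : (0 < a)%N -> (a <= p)%N ->
  (std a : 'cV[F]_p)^T *m std b = (a == b)%:R%:M.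
  case: a => // a _ ap; apply/matrixP => x y; rewrite !ord1 !mxE eqxx mulr1n.
  rewrite (bigD1 (Ordinal ap)) //= !mxE eqxx mul1r big1 ?addr0 // => z.
  by rewrite -val_eqE /= => za; rewrite !mxE eqSS (negbTE za) mul0r.
have E1 := dual _ _ k i0 im; have E2 := dual _ _ l j0 jn.
transitivity (tprod ((std i : 'cV[F]_m)^T *m std k)
                    ((std j : 'cV[F]_n)^T *m std l)).
  exact: (esym (@tprodE _ 1 m 1 _ _ 1 n 1 _ _)).
by rewrite E1 E2 tprod11 -natrM mulnb.
Qed.

End TensorVectors.

Section SubRepresentation.

Variables (F : fieldType) (gT : finGroupType) (G : {group gT}).
Variables (n m : nat) (rG : mx_representation F G n) (B : 'M[F]_(n, m)).
Hypothesis freeB : row_full B.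
Hypothesis stabB : forall g, g \in G -> exists X, rG g *m B = B *m X.

(* The columns of [B] are linearly independent and span an invariant subspace
   of the space of column vectors on which [rG] acts on the left; as
   [pinvmx B] is a left inverse of [B], [colsub_mx g] is the matrix of the
   restriction of [rG g] to this subspace in the basis formed by these
   columns. (The [submod_repr] of the library concerns row spaces instead.) *)
Definition colsub_mx (g : gT) : 'M[F]_m := pinvmx B *m (rG g *m B).

Lemma colsub_mxE g X : rG g *m B = B *m X -> colsub_mx g = X.
Proof. by move=> gB; rewrite /colsub_mx gB mulmxA mulVpmx // mul1mx. Qed.

Lemma colsub_mxK g : g \in G -> B *m colsub_mx g = rG g *m B.
Proof. by move=> /stabB[X gB]; rewrite (colsub_mxE gB). Qed.

Lemma colsub_mx_repr : mx_repr G colsub_mx.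
Proof.
split=> [|g h Gg Gh]; first by rewrite /colsub_mx repr_mx1 mul1mx mulVpmx.
apply: colsub_mxE.
by rewrite repr_mxM // -mulmxA -(colsub_mxK Gh) [LHS]mulmxA -(colsub_mxK Gg) -mulmxA.
Qed.

Definition colsub_repr := MxRepresentation colsub_mx_repr.

End SubRepresentation.

Lemma cols_mx_full (F : fieldType) n (s : seq 'cV[F]_n) (t : seq 'rV[F]_n) :
  (forall i j, (i < size s)%N -> (j < size s)%N ->
     t`_i *m s`_j = (i == j)%:R%:M) -> row_full (cols_mx s).
Proof.
move=> ts; apply/row_fullP; exists (\matrix_(i, j) t`_i 0 j).
apply/matrixP => i j.
have := congr1 (fun M : 'M_1 => M 0 0) (ts i j (ltn_ord i) (ltn_ord j)).
rewrite !mxE eqxx mulr1n => <-; apply: eq_bigr => k _; by rewrite !mxE.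
Qed.

Section Stability.
Variables (C : numClosedFieldType) (n : nat).
Variable rG : mx_representation C [set: H1 C] n.

Lemma H1_stable m (B : 'M[C]_(n, m)) : row_full B ->
  (exists X, rG (H1T C) *m B = B *m X) ->
  (exists X, rG (H1D C) *m B = B *m X) ->
  forall g, g \in [set: H1 C] -> exists X, rG g *m B = B *m X.
Proof.
move=> fullB stabT stabD [x0 x0P] _.
have /asboolP : `[< inH1 x0 >] := x0P.
move=> x0H; elim: x0H x0P => {x0} [||| x y xH IHx yH IHy | x xH IHx] Hx.
- by rewrite (_ : MkH1 Hx = H1T C) //; apply: val_inj.
- by rewrite (_ : MkH1 Hx = H1D C) //; apply: val_inj.
- rewrite (_ : MkH1 Hx = 1%g); last exact: val_inj.
  by exists 1%:M; rewrite repr_mx1 mul1mx mulmx1.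
- pose hx := asboolT xH; pose hy := asboolT yH.
  rewrite (_ : MkH1 Hx = (MkH1 hx * MkH1 hy)%g); last exact: val_inj.
  have [X XE] := IHx hx; have [Y YE] := IHy hy.
  exists (X *m Y).
  by rewrite repr_mxM ?inE // -mulmxA YE !mulmxA XE.
- pose hx := asboolT xH.
  rewrite (_ : MkH1 Hx = (MkH1 hx)^-1%g); last exact: val_inj.
  have [X XE] := IHx hx.
  have gV : rG (MkH1 hx)^-1%g *m rG (MkH1 hx) = 1%:M.
    by rewrite -repr_mxM ?inE // mulVg repr_mx1.
  pose Y := pinvmx B *m (rG (MkH1 hx)^-1%g *m B).
  have YX : Y *m X = 1%:M.
    by rewrite /Y -!mulmxA -XE !mulmxA -(mulmxA (pinvmx B)) gV mulmx1 mulVpmx.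
  exists Y; rewrite -[LHS]mulmx1 -(mulmx1C YX) -!mulmxA (mulmxA B) -XE.
  by rewrite !mulmxA gV mul1mx.
Qed.

(* The columns of [lc_mx m cs] are given by the coefficient lists in [cs]. *)
Definition lc_mx m (cs : seq (seq C)) : 'M[C]_m := \matrix_(i, j) (nth [::] cs j)`_i.

Lemma cols_mx_stable (s : seq 'cV[C]_n) cs g :
  (forall j, (j < size s)%N ->
     rG g *m s`_j = \sum_(k < size s) (nth [::] cs j)`_k *: s`_k) ->
  rG g *m cols_mx s = cols_mx s *m lc_mx (size s) cs.
Proof.
move=> H; apply/matrixP => i j.
have := congr1 (fun M : 'cV_n => M i 0) (H j (ltn_ord j)).
rewrite summxE => E; transitivity ((rG g *m s`_j) i 0).
  by rewrite !mxE; apply: eq_bigr => k _; rewrite !mxE.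
rewrite E !mxE; apply: eq_bigr => k _; by rewrite !mxE mulrC.
Qed.

Lemma lc_mx_std m cs j : (j < m)%N ->
  lc_mx m cs *m std j.+1 = \sum_(k < m) (nth [::] cs j)`_k *: std k.+1.
Proof.
move=> jm; apply/matrixP => i z; rewrite ord1 summxE !mxE.
rewrite (bigD1 (Ordinal jm)) //= !mxE eqxx mulr1 big1 ?addr0; last first.
  by move=> k; rewrite -val_eqE /= => kj; rewrite !mxE eqSS (negbTE kj) mulr0.
rewrite (bigD1 i) //= !mxE eqxx mulr1 big1 ?addr0 // => k.
by rewrite -val_eqE /= => ki; rewrite !mxE eqSS eq_sym (negbTE ki) mulr0.
Qed.

End Stability.

(* [mx_irreducible] refers to invariant spaces of row vectors; this is the same
   as irreducibility of the action on column vectors. *)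
Lemma mx_irreducible_colP (F : fieldType) (gT : finGroupType) (G : {group gT})
    n (rG : mx_representation F G n) :
  mx_irreducible rG <->
  (0 < n)%N /\ forall U : 'M[F]_n,
    (forall g, g \in G -> exists X, rG g *m U = U *m X) ->
    U != 0 -> row_full U.
Proof.
split=> [/mx_irrP | ] [n_gt0 irrG].
  split=> // U stabU nzU; rewrite row_full_unit -row_free_unit -kermx_eq0.
  apply: contraNT nzU => nzK; apply/eqP.
  have modK : mxmodule rG (kermx U).
    apply/mxmoduleP => g Gg; apply/sub_kermxP; have [X gU] := stabU g Gg.
    by rewrite -mulmxA gU mulmxA mulmx_ker mul0mx.
  have /row_fullP[L LK] := irrG _ modK nzK.
  by rewrite -[U]mul1mx -LK -mulmxA mulmx_ker mulmx0.
apply/mx_irrP; split=> // U modU nzU.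
pose K := (kermx U^T)^T.
have UK : U *m K = 0 by rewrite -[U in LHS]trmxK -trmx_mul mulmx_ker trmx0.
have stabK g : g \in G -> exists X, rG g *m K = K *m X.
  move=> Gg; have /submxP[D DE] : ((rG g *m K)^T <= kermx U^T)%MS.
    apply/sub_kermxP; rewrite -trmx_mul mulmxA.
    have /submxP[D ->] : (U *m rG g <= U)%MS by apply: (mxmoduleP modU).
    by rewrite -mulmxA UK mulmx0 trmx0.
  by exists D^T; rewrite -[LHS]trmxK DE trmx_mul.
rewrite row_full_unit -unitmx_tr -row_free_unit -kermx_eq0 -trmx_eq0.
apply: contraNT nzU => nzK; have := irrG K stabK nzK.
by rewrite row_full_unit => KU; rewrite -[U](mulmxK KU) UK mul0mx.
Qed.

(** * The sixteen representations *)

Section Representations.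
Variable C : numClosedFieldType.
Local Notation reprH1 := (mx_representation C [set: H1 C]).
Local Notation representation := (representation C [set: H1 C]).

Definition tens_repr (r s : representation) : representation :=
  Representation (prod_repr r s).

Lemma triv_mx_repr : mx_repr [set: H1 C] (fun _ => 1%:M : 'M[C]_1).
Proof. by split=> // x y _ _; rewrite mulmx1. Qed.
Definition repr_triv : reprH1 1 := MxRepresentation triv_mx_repr.

Lemma det_mx_repr : mx_repr [set: H1 C] (fun g => (\det (val g))%:M : 'M[C]_1).
Proof.
split=> [|x y _ _] /=; first by rewrite det1.
by rewrite det_mulmx scalar_mxM.
Qed.
Definition repr_det : reprH1 1 := MxRepresentation det_mx_repr.

Lemma nat_mx_repr : mx_repr [set: H1 C] (fun g => val g).
Proof. by split. Qed.
Definition repr_nat : reprH1 2 := MxRepresentation nat_mx_repr.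

Definition basis13 : seq 'cV[C]_(2 * 2) :=
  [:: std 1 ⊗ std 1; std 1 ⊗ std 2 + std 2 ⊗ std 1; std 2 ⊗ std 2].
Definition basis15 : seq 'cV[C]_(2 * 3) :=
  [:: std 1 ⊗ std 1; std 1 ⊗ std 2 + std 2 ⊗ std 1;
      std 1 ⊗ std 3 + std 2 ⊗ std 2; std 2 ⊗ std 3].
Definition basis5 : seq 'cV[C]_(2 * 4) :=
  [:: std 1 ⊗ std 1 + std 2 ⊗ std 4; std 1 ⊗ std 3 + std 2 ⊗ std 2].

Local Notation a := ((1 + 'i) / 2 : C).

Local Ltac nat_act := apply/matrixP => -[[|[|[]]] //= ?] ?;
  by rewrite !mxE big_ord_recl big_ord1 !mxE /=; ring.

Lemma nat_T1 : repr_nat (H1T C) *m std 1 = a *: (std 1 + std 2).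
Proof. nat_act. Qed.
Lemma nat_T2 : repr_nat (H1T C) *m std 2 = a *: (std 1 + (-1) *: std 2).
Proof. nat_act. Qed.
Lemma nat_D1 : repr_nat (H1D C) *m std 1 = std 1.
Proof. nat_act. Qed.
Lemma nat_D2 : repr_nat (H1D C) *m std 2 = 'i *: std 2.
Proof. nat_act. Qed.

Local Ltac free_basis := 
  by rewrite /= ?mulmxDr !dual_tensv //=; apply/matrixP => ? ?;
    rewrite !mxE /= ?mulr0n ?mul0rn ?addr0 ?add0r.

Local Ltac stab_basis H :=
  rewrite /= ?mulmxDr !tprod_tensv !H ?big_ord_recl ?big_ord0 /=
    ?(tensvDl, tensvDr, tensvZl, tensvZr, tensv0);
  have := sqrCi C;
  try move: ((1 + 'i) / 2) => ?; move: ('i : C) => ?;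
  let Hi := fresh "Hi" in intro Hi;
  repeat (match goal with |- context [tensv ?u ?v] =>
    move: (tensv u v) => ? end);
  apply/matrixP => ? ?; rewrite !mxE; ring: Hi.

Lemma free13 : row_full (cols_mx basis13).
Proof.
apply: (@cols_mx_full _ _ _
  [:: dualv C 2 2 1 1; dualv C 2 2 1 2; dualv C 2 2 2 2]).
by move=> [|[|[|i]]] [|[|[|j]]] // _ _; free_basis.
Qed.

Definition cs13T : seq (seq C) := [:: [:: a ^+ 2; a ^+ 2; a ^+ 2];
  [:: 2 * a ^+ 2; 0; - 2 * a ^+ 2]; [:: a ^+ 2; - a ^+ 2; a ^+ 2]].
Definition cs13D : seq (seq C) := [:: [:: 1]; [:: 0; 'i]; [:: 0; 0; -1]].

Lemma stab13T (r : reprH1 2) g :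
  r g *m std 1 = a *: (std 1 + std 2) ->
  r g *m std 2 = a *: (std 1 + (-1) *: std 2) ->
  prod_repr r r g *m cols_mx basis13 = cols_mx basis13 *m lc_mx 3 cs13T.
Proof.
move=> r1 r2.
apply: (@cols_mx_stable _ _ _ basis13 cs13T) => -[|[|[|j]]] // _;
  stab_basis (r1, r2).
Qed.

Lemma stab13D (r : reprH1 2) g :
  r g *m std 1 = std 1 -> r g *m std 2 = 'i *: std 2 ->
  prod_repr r r g *m cols_mx basis13 = cols_mx basis13 *m lc_mx 3 cs13D.
Proof.
move=> r1 r2.
apply: (@cols_mx_stable _ _ _ basis13 cs13D) => -[|[|[|j]]] // _;
  stab_basis (r1, r2).
Qed.

Let sym2_TE := stab13T nat_T1 nat_T2.
Let sym2_DE := stab13D nat_D1 nat_D2.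

Definition repr_sym2 : reprH1 3 :=
  colsub_repr free13
    (H1_stable free13 (ex_intro _ _ sym2_TE) (ex_intro _ _ sym2_DE)).

Lemma sym2_T : repr_sym2 (H1T C) = lc_mx 3 cs13T.
Proof. exact: (colsub_mxE free13 sym2_TE). Qed.
Lemma sym2_D : repr_sym2 (H1D C) = lc_mx 3 cs13D.
Proof. exact: (colsub_mxE free13 sym2_DE). Qed.

Definition mx_acts n (r : reprH1 n) g (cs : seq (seq C)) :=
  forall j, (j < n)%N -> r g *m std j.+1 =
    foldr +%R 0 [seq (nth [::] cs j)`_k *: std k.+1 | k <- iota 0 n].

Lemma lc_mx_acts n (r : reprH1 n) g cs : r g = lc_mx n cs -> mx_acts r g cs.
Proof.
move=> rg j jn; rewrite rg lc_mx_std // foldrE big_map.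
by rewrite -(big_mkord xpredT (fun k => (nth [::] cs j)`_k *: std k.+1))
  /index_iota subn0.
Qed.

Lemma free15 : row_full (cols_mx basis15).
Proof.
apply: (@cols_mx_full _ _ _
  [:: dualv C 2 3 1 1; dualv C 2 3 1 2; dualv C 2 3 1 3; dualv C 2 3 2 3]).
by move=> [|[|[|[|i]]]] [|[|[|[|j]]]] // _ _; free_basis.
Qed.

Definition cs15T : seq (seq C) :=
  [:: [:: a ^+ 3; a ^+ 3; a ^+ 3; a ^+ 3];
      [:: 3 * a ^+ 3; a ^+ 3; - a ^+ 3; - 3 * a ^+ 3];
      [:: 3 * a ^+ 3; - a ^+ 3; - a ^+ 3; 3 * a ^+ 3];
      [:: a ^+ 3; - a ^+ 3; a ^+ 3; - a ^+ 3]].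
Definition cs15D : seq (seq C) :=
  [:: [:: 1]; [:: 0; 'i]; [:: 0; 0; -1]; [:: 0; 0; 0; - 'i]].

Lemma stab15T (r : reprH1 2) (s : reprH1 3) g :
  r g *m std 1 = a *: (std 1 + std 2) ->
  r g *m std 2 = a *: (std 1 + (-1) *: std 2) ->
  s g = lc_mx 3 cs13T ->
  prod_repr r s g *m cols_mx basis15 = cols_mx basis15 *m lc_mx 4 cs15T.
Proof.
move=> r1 r2 /lc_mx_acts sg.
have s1 := sg 0%N isT; have s2 := sg 1%N isT; have s3 := sg 2%N isT.
rewrite /= in s1 s2 s3.
apply: (@cols_mx_stable _ _ _ basis15 cs15T) => -[|[|[|[|j]]]] // _;
  stab_basis (r1, r2, s1, s2, s3).
Qed.

Lemma stab15D (r : reprH1 2) (s : reprH1 3) g :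
  r g *m std 1 = std 1 -> r g *m std 2 = 'i *: std 2 ->
  s g = lc_mx 3 cs13D ->
  prod_repr r s g *m cols_mx basis15 = cols_mx basis15 *m lc_mx 4 cs15D.
Proof.
move=> r1 r2 /lc_mx_acts sg.
have s1 := sg 0%N isT; have s2 := sg 1%N isT; have s3 := sg 2%N isT.
rewrite /= in s1 s2 s3.
apply: (@cols_mx_stable _ _ _ basis15 cs15D) => -[|[|[|[|j]]]] // _;
  stab_basis (r1, r2, s1, s2, s3).
Qed.

Let sym3_TE := stab15T nat_T1 nat_T2 sym2_T.
Let sym3_DE := stab15D nat_D1 nat_D2 sym2_D.

Definition repr_sym3 : reprH1 4 :=
  colsub_repr free15
    (H1_stable free15 (ex_intro _ _ sym3_TE) (ex_intro _ _ sym3_DE)).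

Lemma sym3_T : repr_sym3 (H1T C) = lc_mx 4 cs15T.
Proof. exact: (colsub_mxE free15 sym3_TE). Qed.
Lemma sym3_D : repr_sym3 (H1D C) = lc_mx 4 cs15D.
Proof. exact: (colsub_mxE free15 sym3_DE). Qed.

Lemma free5 : row_full (cols_mx basis5).
Proof.
apply: (@cols_mx_full _ _ _ [:: dualv C 2 4 1 1; dualv C 2 4 1 3]).
by move=> [|[|i]] [|[|j]] // _ _; free_basis.
Qed.

Definition cs5T : seq (seq C) :=
  [:: [:: 2 * a ^+ 4; 2 * a ^+ 4]; [:: 6 * a ^+ 4; - 2 * a ^+ 4]].
Definition cs5D : seq (seq C) := [:: [:: 1]; [:: 0; -1]].

Lemma stab5T (r : reprH1 2) (s : reprH1 4) g :
  r g *m std 1 = a *: (std 1 + std 2) ->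
  r g *m std 2 = a *: (std 1 + (-1) *: std 2) ->
  s g = lc_mx 4 cs15T ->
  prod_repr r s g *m cols_mx basis5 = cols_mx basis5 *m lc_mx 2 cs5T.
Proof.
move=> r1 r2 /lc_mx_acts sg.
have s1 := sg 0%N isT; have s2 := sg 1%N isT.
have s3 := sg 2%N isT; have s4 := sg 3%N isT.
rewrite /= in s1 s2 s3 s4.
apply: (@cols_mx_stable _ _ _ basis5 cs5T) => -[|[|j]] // _;
  stab_basis (r1, r2, s1, s2, s3, s4).
Qed.

Lemma stab5D (r : reprH1 2) (s : reprH1 4) g :
  r g *m std 1 = std 1 -> r g *m std 2 = 'i *: std 2 ->
  s g = lc_mx 4 cs15D ->
  prod_repr r s g *m cols_mx basis5 = cols_mx basis5 *m lc_mx 2 cs5D.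
Proof.
move=> r1 r2 /lc_mx_acts sg.
have s1 := sg 0%N isT; have s2 := sg 1%N isT.
have s3 := sg 2%N isT; have s4 := sg 3%N isT.
rewrite /= in s1 s2 s3 s4.
apply: (@cols_mx_stable _ _ _ basis5 cs5D) => -[|[|j]] // _;
  stab_basis (r1, r2, s1, s2, s3, s4).
Qed.

Let sub5_TE := stab5T nat_T1 nat_T2 sym3_T.
Let sub5_DE := stab5D nat_D1 nat_D2 sym3_D.

Definition repr_sub5 : reprH1 2 :=
  colsub_repr free5
    (H1_stable free5 (ex_intro _ _ sub5_TE) (ex_intro _ _ sub5_DE)).

Lemma sub5_T : repr_sub5 (H1T C) = lc_mx 2 cs5T.
Proof. exact: (colsub_mxE free5 sub5_TE). Qed.
Lemma sub5_D : repr_sub5 (H1D C) = lc_mx 2 cs5D.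
Proof. exact: (colsub_mxE free5 sub5_DE). Qed.

Definition rho1 := Representation repr_triv.
Definition rho3 := Representation repr_det.
Definition rho2 := tens_repr rho3 rho3.
Definition rho4 := tens_repr rho2 rho3.

Definition rho10 := Representation repr_nat.
Definition rho7 := tens_repr rho3 rho10.
Definition rho8 := tens_repr rho2 rho10.
Definition rho9 := tens_repr rho4 rho10.

Definition rho13 := Representation repr_sym2.
Definition rho11 := tens_repr rho3 rho13.
Definition rho12 := tens_repr rho4 rho13.
Definition rho14 := tens_repr rho2 rho13.

Definition rho15 := Representation repr_sym3.
Definition rho16 := tens_repr rho3 rho15.

Definition rho5 := Representation repr_sub5.
Definition rho6 := tens_repr rho3 rho5.

(* Ordinals start at 0: [rho i] is the representation numbered i + 1. *)
Definition rho (i : 'I_16) : representation :=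
  tnth [tuple rho1; rho2; rho3; rho4; rho5; rho6; rho7; rho8; rho9; rho10;
              rho11; rho12; rho13; rho14; rho15; rho16] i.

End Representations.

(* Main.v *)
Require Import Defs.
From mathcomp Require Import all_boot all_order all_algebra all_fingroup.
From mathcomp Require Import mxrepresentation character.
From mathcomp Require Import reals.
From mathcomp Require Import complex.
From mathcomp Require Import ring.

Set Implicit Arguments.
Unset Strict Implicit.

Import GRing.Theory Num.Theory.

(** The sixteen degrees have squares summing to
    4 * 1 + 6 * 4 + 4 * 9 + 2 * 16 = 96, and H_1 has at most 96 elements. The
    squares of the degrees of all the irreducible complex representations sum to
    the order of the group, so once the sixteen representations are known to be
    irreducible and pairwise non-isomorphic there is no room for another one
    ([irreps_complete]).

    Irreducibility. On the standard representation, on its symmetric square and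
    cube, and on [rho5], the generator D acts diagonally with distinct
    eigenvalues. Polynomials in D are then all the diagonal matrices, so a
    nonzero invariant subspace contains some basis vector. The matrix of T has
    no zero in its first row or in its first column, so T leads from any basis
    vector to the first one, and from the first one to all the others
    ([diag_cyclic_irr]). The remaining representations are twists of these four
    by a linear character, or linear characters themselves, and twisting
    preserves invariant subspaces ([prod_repr_lin_irr]).

    Non-isomorphism. The degree and the traces of D and of T^2 are isomorphism
    invariants. The traces are Gaussian integers and all three invariants are
    multiplicative on tensor products, so the table [rho_inv] follows from six
    trace computations; its sixteen entries are distinct ([rho_sim_inj]). The
    trace of D alone separates the representations of degrees 1 and 3 and the
    twists of the standard one; [rho5] and [rho6], as well as [rho15] and
    [rho16], have trace 0 at D and are separated by T^2, which acts on each of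
    them as a scalar. *)

(** * Completeness from the sum of the squares of the degrees *)

Section Completeness.
Local Open Scope nat_scope.

(** A further irreducible representation would add a positive square to a sum
    that has already reached the order of the group. *)
Lemma irreps_complete (F : fieldType) (gT : finGroupType) (G : {group gT})
    (sG : irrType F G) (I : finType) (d : I -> nat)
    (r : forall i, mx_representation F G (d i)) :
    (pgroup.pgroup [pchar F]^' G)%R -> group_splitting_field F G ->
    (forall i, mx_irreducible (r i)) ->
    (forall i j, mx_rsim (r i) (r j) -> i = j) ->
    #|G| <= \sum_i d i ^ 2 ->
  forall n (rG : mx_representation F G n),
    mx_irreducible rG -> exists i, mx_rsim rG (r i).
Proof.
move=> F'G splitG irr_r r_inj leG n rG irrG.
pose c i := irr_comp sG (r i).
have simc i : mx_rsim (r i) (irr_repr (c i)) by apply: rsim_irr_comp_pchar.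
have c_inj : injective c.
  move=> i j eq_c; apply: r_inj; apply: mx_rsim_trans (simc i) _.
  by rewrite eq_c; apply: mx_rsim_sym.
have simG := rsim_irr_comp_pchar sG F'G irrG.
have [/codomP[i cE] | notin] := boolP (irr_comp sG rG \in codom c).
  exists i; apply: mx_rsim_trans simG _.
  by rewrite cE; apply: mx_rsim_sym.
(* An irreducible component of the regular representation is determined by the
   isomorphism class, so the [r i] account for distinct terms of the sum. *)
have sum_c : \sum_i d i ^ 2 = \sum_(k in codom c) irr_degree k ^ 2.
  rewrite -big_uniq; last exact/injectiveP.
  by rewrite big_image; apply: eq_bigr => i _; congr (_ ^ 2); case: (simc i).
have: \sum_i d i ^ 2 < #|G|.
  rewrite -(sum_irr_degree_pchar sG F'G splitG) sum_c.
  rewrite [X in _ < X](bigID [in codom c]) /= -[X in X < _]addn0 ltn_add2l.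
  by rewrite (bigD1 (irr_comp sG rG)) //= addn_gt0 expn_gt0 irr_degree_gt0.
by rewrite ltnNge leG.
Qed.

End Completeness.

(** * Irreducibility criteria *)

Section Irreducibility.
Local Open Scope ring_scope.
Variables (F : fieldType) (gT : finGroupType) (G : {group gT}).

(** As the eigenvalues are distinct, the projection onto the j-th coordinate is,
    up to a scalar, a polynomial in the diagonal matrix, and so preserves [U]. *)
Lemma diag_submx n (d u : 'rV[F]_n.+1) (U : 'M[F]_n.+1) j :
    injective (d 0) -> stablemx U (diag_mx d) -> (u <= U)%MS -> u 0 j != 0 ->
  ((delta_mx 0 j : 'rV_n.+1) <= U)%MS.
Proof.
move=> d_inj stabU uU uj.
pose p := \prod_(k | k != j) ('X - (d 0 k)%:P) : {poly F}.
have pE l : p.[d 0 l] = \prod_(k | k != j) (d 0 l - d 0 k).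
  by rewrite horner_prod; apply: eq_bigr => k _; rewrite !hornerE.
have pj : p.[d 0 j] != 0.
  rewrite pE prodf_seq_neq0; apply/allP => k _; apply/implyP => kj.
  by rewrite subr_eq0 inj_eq // eq_sym.
have uP : (u *m horner_mx (diag_mx d) p <= U)%MS.
  exact: submx_trans (submxMr _ uU) (horner_mx_stable _ stabU).
suff E : u *m horner_mx (diag_mx d) p = (u 0 j * p.[d 0 j]) *: delta_mx 0 j.
  by move: uP; rewrite E eqmx_scale ?mulf_neq0.
rewrite horner_mx_diag mul_mx_diag; apply/rowP => l; rewrite !mxE eqxx /=.
have [-> | lj] := eqVneq l j; first by rewrite mulr1.
by rewrite (pE l) (bigD1 l) //= subrr mul0r !mulr0.
Qed.

(** By [diag_submx], an invariant subspace contains a basis vector as soon as one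
    of its elements has a nonzero coordinate there; the nonzero entries of
    [rG y] give the path j -> i0 -> k between any two basis vectors. *)
Lemma diag_cyclic_irr n (rG : mx_representation F G n.+1) x y (d : 'rV_n.+1) i0 :
    x \in G -> y \in G -> rG x = diag_mx d -> injective (d 0) ->
    (forall j, rG y j i0 != 0) -> (forall j, rG y i0 j != 0) ->
  mx_irreducible rG.
Proof.
move=> Gx Gy xE d_inj col0 row0; apply/mx_irrP; split=> // U modU nzU.
have stab z : z \in G -> (U *m rG z <= U)%MS by apply: mxmoduleP.
pose e j : 'rV[F]_n.+1 := delta_mx 0 j.
have coord (u : 'rV_n.+1) j : (u <= U)%MS -> u 0 j != 0 -> (e j <= U)%MS.
  by apply: diag_submx d_inj _; rewrite -xE stab.
have step j k : (e j <= U)%MS -> rG y j k != 0 -> (e k <= U)%MS.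
  move=> jU jk; apply: coord (_ : row j (rG y) <= U)%MS _; last by rewrite mxE.
  by rewrite rowE (submx_trans (submxMr _ jU)) ?stab.
have [i /existsP[j Uij]] : exists i, [exists j, U i j != 0].
  apply/existsP; apply: contraNT nzU => /existsPn U0; apply/eqP/matrixP => i j.
  by rewrite mxE; apply/eqP; have /existsPn/(_ j) := U0 i; rewrite negbK.
have ej : (e j <= U)%MS.
  by apply: coord (row_sub i U) _; rewrite mxE.
rewrite -sub1mx; apply/row_subP => k; rewrite row1.
exact: step (step _ _ ej (col0 j)) (row0 k).
Qed.

(** Tensoring with a linear character multiplies each matrix by a nonzero scalar,
    which does not change the invariant subspaces. *)
Lemma prod_repr_lin_irr n (r1 : mx_representation F G 1)
    (r2 : mx_representation F G n) :
  mx_irreducible r2 -> mx_irreducible (prod_repr r1 r2).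
Proof.
move=> /mx_irrP[n_gt0 irr2].
have nz1 x : x \in G -> r1 x 0 0 != 0.
  move=> Gx; have := repr_mx_unit r1 Gx.
  by rewrite unitmxE det_mx11 unitfE.
(* The degree [1 * n] of the product equals [n] only propositionally; the cast
   disappears once it is generalised to an arbitrary degree [m]. *)
suff cast m (e : n = m) (r : mx_representation F G m) :
    {in G, forall x, r x = castmx (e, e) (r1 x 0 0 *: r2 x)} -> mx_irreducible r.
  exact: cast (prod_repr_lin r1 r2).
case: m / e r => r rE; apply/mx_irrP; split=> // U modU; apply: irr2.
apply/mxmoduleP => x Gx; have := mxmoduleP modU x Gx.
by rewrite rE // castmx_id -scalemxAr eqmx_scale ?nz1.
Qed.

End Irreducibility.

(** * The order of the group, and Gaussian integers *)

Section Group.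
Local Open Scope ring_scope.
Variable C : numClosedFieldType.

(** Every element of H_1 is encoded in the explicit list of 96 codes. *)
Lemma card_H1_le : (#|[set: H1 C]| <= 96)%N.
Proof.
rewrite cardsT cardE -(size_map val).
have -> : 96%N = size (map (Finiteness.decode C) Finiteness.elts).
  by rewrite size_map.
apply: uniq_leq_size.
  by rewrite map_inj_uniq ?enum_uniq //; apply: val_inj.
move=> _ /mapP[x _ ->]; have [l lP ->] := Finiteness.inH1_decode (H1_inH1 x).
exact: map_f.
Qed.

Local Notation gval := (Finiteness.gval C).

Lemma gval_inj : injective gval.
Proof.
move=> [a b] [c d]; rewrite /Finiteness.gval /= ![_%:~R * 'i]mulrC => E.
have r (k : int) : k%:~R \is @Num.real C by rewrite realz.
move: (congr1 (fun z => 'Re z) E) (congr1 (fun z => 'Im z) E).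
by rewrite !Re_rect ?Im_rect // => /intr_inj-> /intr_inj->.
Qed.

Lemma gval_row_inj n (s : seq Finiteness.gauss) : uniq s -> size s = n ->
  injective ((\row_(j < n) gval (nth (0, 0) s j)) 0).
Proof.
move=> s_uniq sz j k; rewrite !mxE => /gval_inj /eqP.
by rewrite nth_uniq ?sz // => /eqP/val_inj.
Qed.

(** * Irreducibility of the sixteen representations *)

Lemma matT_coef_neq0 : (1 + 'i) / 2 != 0 :> C.
Proof.
rewrite mulf_neq0 ?invr_eq0 ?pnatr_eq0 //; apply/eqP => E.
have /eqP : (1 + 'i) * (1 - 'i) = 2 :> C.
  by have := sqrCi C; move: 'i => w H; ring: H.
by rewrite E mul0r eq_sym pnatr_eq0.
Qed.

Local Ltac diagonal :=
  apply/matrixP => -[[|[|[|[|?]]]] ?] // -[[|[|[|[|?]]]] ?] //;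
  rewrite !mxE /Finiteness.gval /= ?mulr1n ?mulr0n //; ring.
Local Ltac nonzero := case=> [[|[|[|[|?]]]] ?] //=; rewrite !mxE /=;
  have := matT_coef_neq0; move: ((1 + 'i) / 2) => ? /negbTE;
  let a0 := fresh "a0" in intro a0;
  rewrite ?mulf_eq0 ?expf_eq0 ?oppr_eq0 ?pnatr_eq0 ?oner_eq0 ?a0.

(** The eigenvalues of D are given as Gaussian integers, so that their being
    distinct is checked by computation. *)
Lemma H1_repr_irr n (r : mx_representation C [set: H1 C] n.+1)
    (s : seq Finiteness.gauss) :
    uniq s -> size s = n.+1 ->
    r (H1D C) = diag_mx (\row_(j < n.+1) gval (nth (0, 0) s j)) ->
    (forall j, r (H1T C) j 0 != 0) -> (forall j, r (H1T C) 0 j != 0) ->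
  mx_irreducible r.
Proof.
move=> s_uniq sz rD; apply: diag_cyclic_irr rD _; rewrite ?inE //.
exact: gval_row_inj.
Qed.

Lemma nat_irr : mx_irreducible (repr_nat C).
Proof.
apply: (@H1_repr_irr _ _ [:: (1, 0); (0, 1)]) => //; first by diagonal.
- by nonzero.
- by nonzero.
Qed.

Lemma sym2_irr : mx_irreducible (repr_sym2 C).
Proof.
apply: (@H1_repr_irr _ _ [:: (1, 0); (0, 1); (-1, 0)]) => //.
- by rewrite sym2_D; diagonal.
- by rewrite sym2_T; nonzero.
- by rewrite sym2_T; nonzero.
Qed.

Lemma sym3_irr : mx_irreducible (repr_sym3 C).
Proof.
apply: (@H1_repr_irr _ _ [:: (1, 0); (0, 1); (-1, 0); (0, -1)]) => //.
- by rewrite sym3_D; diagonal.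
- by rewrite sym3_T; nonzero.
- by rewrite sym3_T; nonzero.
Qed.

Lemma sub5_irr : mx_irreducible (repr_sub5 C).
Proof.
apply: (@H1_repr_irr _ _ [:: (1, 0); (-1, 0)]) => //.
- by rewrite sub5_D; diagonal.
- by rewrite sub5_T; nonzero.
- by rewrite sub5_T; nonzero.
Qed.

Lemma rho_irr i : mx_irreducible (rho C i).
Proof.
have lin (r : mx_representation C [set: H1 C] 1) : mx_irreducible r.
  exact/mx_abs_irrW/linear_mx_abs_irr.
have [n2 s2 s3 s5] := And4 nat_irr sym2_irr sym3_irr sub5_irr.
case: i => m m_lt; rewrite /rho (tnth_nth (rho1 C)) /=.
by do 16?[case: m m_lt => [|m] m_lt; first by do ?apply: prod_repr_lin_irr].
Qed.

(** * Invariants that separate the sixteen representations *)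

Definition invariants := (nat * Finiteness.gauss * Finiteness.gauss)%type.

Definition has_invariants (r : representation C [set: H1 C])
    (t : invariants) : Prop :=
  [/\ rdegree r = t.1.1, \tr (r (H1D C)) = gval t.1.2
    & \tr (r (H1T C * H1T C)%g) = gval t.2].

Definition tens_inv (s t : invariants) : invariants :=
  ((s.1.1 * t.1.1)%N, Finiteness.gmul s.1.2 t.1.2, Finiteness.gmul s.2 t.2).

Lemma tens_invP r1 r2 s t : has_invariants r1 s -> has_invariants r2 t ->
  has_invariants (tens_repr r1 r2) (tens_inv s t).
Proof.
move=> [d1 x1 y1] [d2 x2 y2]; split; rewrite /= ?d1 ?d2 //.
- by rewrite mxtrace_prod x1 x2 Finiteness.gvalM.
- by rewrite mxtrace_prod y1 y2 Finiteness.gvalM.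
Qed.

(** The table repeats the construction of the representations, so that tensor
    products are covered by [tens_invP]. *)
Definition rho_inv : 16.-tuple invariants :=
  let t1 := (1%N, (1, 0), (1, 0)) in
  let t3 := (1%N, (0, 1), (-1, 0)) in
  let t2 := tens_inv t3 t3 in
  let t4 := tens_inv t2 t3 in
  let t5 := (2%N, (0, 0), (2, 0)) in
  let t10 := (2%N, (1, 1), (0, 2)) in
  let t13 := (3%N, (0, 1), (-3, 0)) in
  let t15 := (4%N, (0, 0), (0, -4)) in
  [tuple t1; t2; t3; t4; t5; tens_inv t3 t5;
         tens_inv t3 t10; tens_inv t2 t10; tens_inv t4 t10; t10;
         tens_inv t3 t13; tens_inv t4 t13; t13; tens_inv t2 t13;
         t15; tens_inv t3 t15].

Local Ltac trace :=
  rewrite /mxtrace ?(mxE, big_ord_recl, big_ord0) /= /Finiteness.gval /=;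
  have := sqrCi C; move: 'i => ?;
  let H := fresh "H" in intro H; field: H.

Lemma has_invariants_mx n (r : mx_representation C [set: H1 C] n) A B x y :
    r (H1D C) = A -> r (H1T C) = B -> \tr A = gval x -> \tr (B *m B) = gval y ->
  has_invariants (Representation r) (n, x, y).
Proof. by move=> <- <- rx ry; split; rewrite //= repr_mxM ?inE. Qed.

Lemma triv_inv : has_invariants (rho1 C) (1%N, (1, 0), (1, 0)).
Proof. by apply: has_invariants_mx => //=; trace. Qed.

Lemma det_inv : has_invariants (rho3 C) (1%N, (0, 1), (-1, 0)).
Proof.
by apply: has_invariants_mx => //=; rewrite !(expand_det_row _ 0) /cofactor
  !(big_ord_recl, big_ord0) !det_mx11; trace.
Qed.

Lemma nat_inv : has_invariants (rho10 C) (2%N, (1, 1), (0, 2)).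
Proof. by apply: has_invariants_mx => //=; trace. Qed.

Lemma sym2_inv : has_invariants (rho13 C) (3%N, (0, 1), (-3, 0)).
Proof. by apply: has_invariants_mx (sym2_D C) (sym2_T C) _ _; trace. Qed.

Lemma sym3_inv : has_invariants (rho15 C) (4%N, (0, 0), (0, -4)).
Proof. by apply: has_invariants_mx (sym3_D C) (sym3_T C) _ _; trace. Qed.

Lemma sub5_inv : has_invariants (rho5 C) (2%N, (0, 0), (2, 0)).
Proof. by apply: has_invariants_mx (sub5_D C) (sub5_T C) _ _; trace. Qed.

Lemma rho_invP i : has_invariants (rho C i) (tnth rho_inv i).
Proof.
have t1 := triv_inv; have t3 := det_inv; have t5 := sub5_inv.
have t10 := nat_inv; have t13 := sym2_inv; have t15 := sym3_inv.
case: i => m m_lt.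
rewrite /rho (tnth_nth (rho1 C)) (tnth_nth (0%N, (0, 0), (0, 0))) /=.
by do 16?[case: m m_lt => [|m] m_lt; first by do ?apply: tens_invP].
Qed.

Lemma sim_invariants (r1 r2 : representation C [set: H1 C]) s t :
  mx_rsim r1 r2 -> has_invariants r1 s -> has_invariants r2 t -> s = t.
Proof.
case: s t => [[m x] y] [[n x'] y'] sim [/= <- xE yE] [/= <- xE' yE'].
have trE g : \tr (r1 g) = \tr (r2 g) by rewrite (mxtrace_rsim sim) ?inE.
congr (_, _, _); first by case: sim.
- by apply: gval_inj; rewrite -xE -xE' trE.
- by apply: gval_inj; rewrite -yE -yE' trE.
Qed.

Lemma rho_sim_inj i j : mx_rsim (rho C i) (rho C j) -> i = j.
Proof.
move=> sim; apply: (tuple_uniqP rho_inv isT).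
exact: sim_invariants sim (rho_invP i) (rho_invP j).
Qed.

Lemma sum_rho_degree : (\sum_i rdegree (rho C i) ^ 2 = 96)%N.
Proof.
rewrite (eq_bigr (fun i => (tnth rho_inv i).1.1 ^ 2)%N).
  by rewrite -(big_tuple _ _ rho_inv xpredT (fun t => t.1.1 ^ 2)%N) unlock.
by move=> i _; congr (_ ^ 2)%N; case: (rho_invP i).
Qed.

Lemma pchar'_group (gT : finGroupType) (G : {group gT}) :
  pgroup.pgroup [pchar C]^' G.
Proof. by apply/pgroup.pgroupP => p _ _; rewrite inE /= pchar_num. Qed.

End Group.

Theorem mainTheorem3 (R : realType) :
  [/\ (* each rho_i is irreducible *)
      forall i : 'I_16, mx_irreducible (rho R[i] i),
      (* they are pairwise non-isomorphic *)
      forall i j : 'I_16, mx_rsim (rho R[i] i) (rho R[i] j) -> i = j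
    & (* every irreducible complex representation is isomorphic to one of them *)
      forall (n : nat) (rG : mx_representation R[i] [set: H1 R[i]] n),
        mx_irreducible rG -> exists i : 'I_16, mx_rsim rG (rho R[i] i)].
Proof.
split; [exact: rho_irr | exact: rho_sim_inj |].
apply: (irreps_complete (DecSocleType (regular_repr _ _))).
- exact: pchar'_group.
- exact: group_closure_closed_field.
- exact: rho_irr.
- exact: rho_sim_inj.
by rewrite sum_rho_degree; apply: card_H1_le.
Qed.
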